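(* Suppose $(a_{n})_{n\geq 1}$ is a sequence of nonzero real numbers for which the limit \[ p=\lim_{n\to\infty}n\left(\left|\frac{a_{n}}{a_{n+1}}\right|-1\right) \] exists as a finite value. If $p>0$, then the sequence $(a_{n})$ converges to $0$. *)

(* Defs.v *)
From HB Require Import structures.
From mathcomp Require Import all_boot all_order all_algebra.
From mathcomp Require Import all_classical all_reals all_analysis.

(* Main.v *)
Require Import Defs.
From mathcomp Require Import all_boot all_order all_algebra.
From mathcomp Require Import all_classical all_reals all_analysis.
From mathcomp Require Import lra.
Import Order.TTheory GRing.Theory Num.Theory.
Import numFieldNormedType.Exports.
Local Open Scope classical_set_scope.
Local Open Scope ring_scope.

(** The limit hypothesis says that [|a n| / |a n.+1|] behaves like
    [1 + p / n]. Hence, for any [0 < q < p], eventually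
    [|a n.+1| * (1 + q / n) <= |a n|]. Chaining these inequalities from an
    index [N] on gives [|a M| * \prod_(N <= n < M) (1 + q / n) <= |a N|], and
    the product is at least [1 + q * \sum_(N <= n < M) 1 / n], which tends to
    infinity because the harmonic series diverges. So [a] tends to [0].

    The finite inequality is [decay_sum_bound], and its consequence for a
    divergent nonnegative series is [cvg0_of_decay_dvg_series]; below, the
    latter is applied with [q = p / 2]. *)

(** Since [(1 + s) * (1 + u n) >= 1 + s + u n] for [s, u n >= 0], the product
    bound that one gets by iterating the hypothesis can be carried through the
    induction directly as a bound with the sum of the [u n]. *)
Lemma decay_sum_bound (R : realDomainType) (b u : nat -> R) (N M : nat) :
  (forall n, 0 <= b n) -> (forall n, 0 <= u n) ->
  (forall n, (N <= n)%N -> b n.+1 * (1 + u n) <= b n) ->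
  (N <= M)%N ->
  b M * (1 + \sum_(N <= n < M) u n) <= b N.
Proof.
move=> b_ge0 u_ge0 decay /subnKC <-; elim: (M - N)%N => [|k IHk].
  by rewrite addn0 big_geq// addr0 mulr1.
rewrite addnS big_nat_recr ?leq_addr//=.
set s := \sum_(N <= n < N + k) u n in IHk *.
have s_ge0 : 0 <= s by apply: sumr_ge0.
apply: le_trans IHk.
have := ler_wpM2r (addr_ge0 ler01 s_ge0) (decay _ (leq_addr k N)).
apply: le_trans.
have := mulr_ge0 (b_ge0 (N + k).+1) (mulr_ge0 (u_ge0 (N + k)%N) s_ge0).
by lra.
Qed.

(** By [decay_sum_bound], for a fixed late [N] the term [b M] is at most [b N]
    divided by one plus the sum of the [u n] from [N] to [M], and the partial
    sums of a divergent nonnegative series exceed any given number. *)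
Lemma cvg0_of_decay_dvg_series (R : realType) (b u : nat -> R) :
  (forall n, 0 <= b n) -> (forall n, 0 <= u n) ->
  ~ cvgn (series u) ->
  (\forall n \near \oo, b n.+1 * (1 + u n) <= b n) ->
  b @ \oo --> (0 : R).
Proof.
move=> b_ge0 u_ge0 u_dvg [N _ decay].
have ndu : nondecreasing_seq (series u) by apply: nondecreasing_series.
have /cvgryPge u_oo := nondecreasing_dvgn_lt ndu u_dvg.
apply/cvgr0Pnorm_le => e e_gt0.
have Nlarge : \forall n \near \oo, (N <= n)%N by exists N.
(* Past this threshold the partial sum of u from N on is at least b N / e,
   so b n > e would contradict the bound b n * (1 + sum) <= b N. *)
have slarge := u_oo (series u N + b N / e).
near=> n.
have Nn : (N <= n)%N by near: n.
have sn : series u N + b N / e <= series u n by near: n.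
have bound := @decay_sum_bound _ b u N n b_ge0 u_ge0 decay Nn.
rewrite -(sub_series_geq _ Nn) in bound.
rewrite ger0_norm// leNgt; apply/negP => e_lt_bn.
have D_ge : b N / e <= series u n - series u N by lra.
have D_ge0 : 0 <= series u n - series u N.
  by apply: le_trans D_ge; rewrite divr_ge0// ltW.
have eD : b N <= e * (series u n - series u N) by rewrite mulrC -ler_pdivrMr.
have := ler_wpM2r D_ge0 (ltW e_lt_bn).
by lra.
Unshelve. all: by end_near.
Qed.

(* Only the terms a n with n >= 1 matter; the value a 0 is unconstrained. *)
Theorem proposition2 (R : realType) (a : nat -> R) (p : R)
  (a_neq0 : forall n : nat, (1 <= n)%N -> a n != 0)
  (a_lim : (fun n : nat => n%:R * (`|a n / a n.+1| - 1)) @ \oo --> p)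
  (p_gt0 : 0 < p) :
  a @ \oo --> (0 : R).
Proof.
suff abs_cvg : (fun n => `|a n|) @ \oo --> (0 : R) by exact: norm_cvg0 abs_cvg.
rewrite -cvg_shiftS.
have q_gt0 : 0 < p / 2 by rewrite divr_gt0.
(* The index is shifted by one because harmonic n is 1 / (n + 1). *)
refine (@cvg0_of_decay_dvg_series R (fun n => `|a n.+1|)
  (fun n => p / 2 * harmonic n) _ _ _ _) => [n|n||].
- exact: normr_ge0.
- by rewrite mulr_ge0 ?harmonic_ge0 ?ltW.
- move=> /(@is_cvg_seriesZ _ _ (p / 2)^-1).
  by rewrite scalerA mulVf ?gt_eqF// scale1r; exact: dvg_harmonic.
have q_lt_p : p / 2 < p by lra.
have [N _ ratio_ge] := cvgr_ge _ a_lim _ q_lt_p.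
exists N => // n /= Nn.
have /= := ratio_ge n.+1 (leqW Nn).
rewrite normrM normfV -ler_pdivrMl ?ltr0n// lerBrDl.
rewrite ler_pdivlMr ?normr_gt0 ?a_neq0//.
by rewrite mulrC (mulrC (p / 2)).
Qed.
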